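(* Let $m,N,s$ be positive integers with $m\le N$ and $m\mid s$, and let $\mathbb{F}$ be a finite field with $|\mathbb{F}|\ge N$ containing a primitive $s$-th root of unity $\omega_s$. Consider the distributed Fourier transform problem of computing $X=\mathcal{F}\{x\}$, $x\in\mathbb{F}^s$, using $N$ workers that can each store and process a $\frac1m$ fraction of the input vector. Then the recovery threshold $K^*=m$ is optimal: the minimum of the recovery thresholds over all computation strategies equals $m$.
   Context: Discrete Fourier transform: for $x=(x_0,\dots,x_{s-1})\in\mathbb{F}^s$, $X=\mathcal{F}\{x\}\in\mathbb{F}^s$ is defined by $X_i=\sum_{j=0}^{s-1}x_j\,\omega_s^{ij}$ for $i\in\{0,\dots,s-1\}$. Computation strategy: a tuple of $N$ encoding functions $f_0,\dots,f_{N-1}$ and $N$ computing functions $g_0,\dots,g_{N-1}$, where $f_i:\mathbb{F}^s\to\mathbb{F}^{s/m}$ and $g_i:\mathbb{F}^{s/m}\to\mathbb{F}^{s/m}$ are arbitrary functions. On input $x$, worker $i$ stores $a_i=f_i(x)\in\mathbb{F}^{s/m}$, computes $b_i=g_i(a_i)\in\mathbb{F}^{s/m}$, and returns $b_i$ to the master. Recoverability: for an integer $k\in\{0,\dots,N\}$, a computation strategy is $k$-recoverable if for every set $S\subseteq\{0,\dots,N-1\}$ with $|S|=k$ there is a decoding function $d_S$ such that $d_S\big((b_i)_{i\in S}\big)=\mathcal{F}\{x\}$ for all $x\in\mathbb{F}^s$. The recovery threshold of a computation strategy is the minimum $k$ for which it is $k$-recoverable (a strategy that is not $k$-recoverable for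 any $k\in\{0,\dots,N\}$ has no recovery threshold and is disregarded in the minimum). *)

(* Defs.v *)
From HB Require Import structures.
From mathcomp Require Import all_boot all_order all_algebra.

Set Implicit Arguments.
Unset Strict Implicit.
Unset Printing Implicit Defensive.

Import GRing.Theory.
Local Open Scope ring_scope.

Definition dft (F : fieldType) (s : nat) (w : F) (x : 'rV[F]_s) : 'rV[F]_s :=
  \row_(i < s) \sum_(j < s) x 0 j * w ^+ (i * j).

(* Meaningful only when m divides s, since s %/ m truncates. *)
Record strategy (F : fieldType) (N s m : nat) := Strategy {
  encode : 'I_N -> 'rV[F]_s -> 'rV[F]_(s %/ m);
  compute : 'I_N -> 'rV[F]_(s %/ m) -> 'rV[F]_(s %/ m)
}.

Definition worker_result (F : fieldType) (N s m : nat)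
    (C : strategy F N s m) (x : 'rV[F]_s) (i : 'I_N) : 'rV[F]_(s %/ m) :=
  compute C i (encode C i x).

Definition results (F : fieldType) (N s m : nat) (C : strategy F N s m)
    (S : {set 'I_N}) (x : 'rV[F]_s) :
    {ffun {i : 'I_N | i \in S} -> 'rV[F]_(s %/ m)} :=
  [ffun i => worker_result C x (val i)].

Definition recoverable (F : fieldType) (N s m : nat) (w : F)
    (C : strategy F N s m) (k : nat) : Prop :=
  forall S : {set 'I_N}, #|S| = k ->
    exists d : {ffun {i : 'I_N | i \in S} -> 'rV[F]_(s %/ m)} -> 'rV[F]_s,
      forall x : 'rV[F]_s, d (results C S x) = dft w x.

Definition is_minimum (P : nat -> Prop) (k : nat) : Prop :=
  P k /\ forall j : nat, P j -> (k <= j)%N.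

(* A relation rather than a function, because a strategy that is recoverable
   for no k <= N has no threshold.  The bound k <= N matters: for k > N,
   recoverability holds vacuously. *)
Definition recovery_threshold (F : fieldType) (N s m : nat) (w : F)
    (C : strategy F N s m) (k : nat) : Prop :=
  is_minimum (fun k' => (k' <= N)%N /\ recoverable w C k') k.

(* Main.v *)
Require Import Defs.
From HB Require Import structures.
From mathcomp Require Import all_boot all_order all_algebra.

Set Implicit Arguments.
Unset Strict Implicit.
Unset Printing Implicit Defensive.

Import GRing.Theory.
Local Open Scope ring_scope.

(* A polynomial of size at most n is determined by its values at n distinct
   points.  Applied at the powers of w, this makes the transform injective, so
   k workers, who return at most |F|^(k s/m) distinct tuples, can only
   distinguish all |F|^s inputs if k >= m.  Conversely, cut the input into m
   blocks, regard them as the coefficients of a polynomial and let worker i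
   return its value at the i-th of N distinct points of F: any m workers
   determine the input.  As the encoding functions are arbitrary, no
   computation beyond the encoding is required. *)

Lemma poly_eq_on (F : idomainType) (I : finType) (a : I -> F) (S : {set I})
    (p q : {poly F}) :
  {in S &, injective a} -> (size p <= #|S|)%N -> (size q <= #|S|)%N ->
  {in S, forall i, p.[a i] = q.[a i]} -> p = q.
Proof.
move=> a_inj sz_p sz_q eq_pq; apply/eqP; rewrite -subr_eq0; apply/eqP.
apply: (@roots_geq_poly_eq0 _ _ [seq a i | i <- enum S]).
- apply/allP => _ /mapP [i /[!mem_enum] iS ->].
  by rewrite /root !hornerE eq_pq // subrr.
- rewrite map_inj_in_uniq ?enum_uniq // => i j.
  by rewrite !mem_enum; apply: a_inj.
- rewrite size_map -cardE (leq_trans (size_polyD _ _)) //.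
  by rewrite size_polyN geq_max sz_p.
Qed.

Lemma horner_rVpolyE (R : nzRingType) (n : nat) (u : 'rV[R]_n) (c : R) :
  (rVpoly u).[c] = \sum_(j < n) u 0 j * c ^+ j.
Proof. by rewrite horner_poly; apply: eq_bigr => j _; rewrite valK. Qed.

Lemma dft_inj (F : fieldType) (s : nat) (w : F) :
  s.-primitive_root w -> injective (@dft F s w).
Proof.
move=> w_prim x y eq_xy; rewrite -[x]rVpolyK -[y]rVpolyK; congr poly_rV.
(* Entry [i] of the transform is the value at [w ^+ i] of the polynomial with coefficients [x]. *)
apply: (@poly_eq_on _ 'I_s (fun i => w ^+ i) setT).
- move=> i j _ _ /eqP; rewrite (eq_prim_root_expr w_prim) !modn_small //.
  by move/eqP/val_inj.
- by rewrite cardsT card_ord size_poly.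
- by rewrite cardsT card_ord size_poly.
- move=> i _; have /rowP/(_ i) := eq_xy; rewrite !mxE !horner_rVpolyE.
  by under eq_bigr do rewrite exprM; under [RHS]eq_bigr do rewrite exprM.
Qed.

(** Provides decoders: as [A] is finite, a preimage of [b] can be searched for; [d0] is the junk
    value off the image of [r]. *)
Lemma factor_through (A : finType) (B D : eqType) (d0 : D)
    (r : A -> B) (f : A -> D) :
  (forall x y, r x = r y -> f x = f y) -> exists d, forall x, d (r x) = f x.
Proof.
move=> rf; exists (fun b => if [pick x | r x == b] is Some x then f x else d0).
by move=> x; case: pickP => [y /eqP/rf | /(_ x)/eqP].
Qed.

Lemma recoverable_geq (F : finFieldType) (m N s : nat) (w : F)
    (C : strategy F N s m) (k : nat) :
  (0 < s)%N -> (m %| s)%N -> s.-primitive_root w -> (k <= N)%N ->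
  recoverable w C k -> (m <= k)%N.
Proof.
move=> s_gt0 dvd_ms w_prim le_kN rec_k.
(* Here [k <= N] is essential: it makes the number of [k]-subsets, a binomial coefficient,
   positive. *)
have [S cardS] : exists S : {set 'I_N}, #|S| = k.
  have: (0 < #|[set S : {set 'I_N} | #|S| == k]|)%N.
    by rewrite card_draws card_ord bin_gt0.
  by case/card_gt0P=> S; rewrite inE => /eqP; exists S.
have [d dE] := rec_k S cardS.
have r_inj : injective (results C S).
  by move=> x y eq_xy; apply: (dft_inj w_prim); rewrite -!dE eq_xy.
have := leq_card _ r_inj.
(* Both cardinalities are powers of [#|F|]; comparing exponents gives [s <= s %/ m * k]. *)
rewrite card_ffun !card_mx card_sig cardS !mul1n -expnM.
rewrite leq_exp2l ?card_finNzRing_gt1 // => le_s.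
have q_gt0 : (0 < s %/ m)%N.
  by rewrite divn_gt0 ?(dvdn_gt0 s_gt0) // dvdn_leq.
by rewrite -(leq_pmul2l q_gt0) divnK.
Qed.

(** The cast is there because [s] and [m * (s %/ m)] are not convertible. *)
Definition blocks (R : Type) (s m : nat) (dvd_ms : (m %| s)%N)
    (x : 'rV[R]_s) : 'M[R]_(m, s %/ m) :=
  vec_mx (castmx (erefl 1%N, esym (etrans (mulnC _ _) (divnK dvd_ms))) x).

Lemma blocks_inj (R : Type) (s m : nat) (dvd_ms : (m %| s)%N) :
  injective (@blocks R s m dvd_ms).
Proof. by move=> x y /(can_inj vec_mxK)/(can_inj (castmxK _ _)). Qed.

(** A Reed-Solomon code across the blocks: worker [i] stores the sum over [j] of [a i ^+ j] times
    block [j]. *)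
Definition block_code (F : fieldType) (N s m : nat) (dvd_ms : (m %| s)%N)
    (a : 'I_N -> F) : strategy F N s m :=
  Strategy
    (fun i x => \row_l (rVpoly (row l (blocks dvd_ms x)^T)).[a i])
    (fun _ => id).

Lemma block_code_recoverable (F : finFieldType) (N s m : nat)
    (dvd_ms : (m %| s)%N) (a : 'I_N -> F) (w : F) :
  injective a -> recoverable w (block_code dvd_ms a) m.
Proof.
move=> a_inj S cardS; apply: factor_through (0 : 'rV_s) _ _ _ => x y eq_xy.
congr dft; apply: (@blocks_inj _ _ _ dvd_ms).
apply: trmx_inj; apply/row_matrixP => l.
rewrite -[LHS]rVpolyK -[RHS]rVpolyK; congr poly_rV.
apply: (@poly_eq_on _ _ a S) => [i j _ _ /a_inj //||| i iS].
- by rewrite cardS size_poly.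
- by rewrite cardS size_poly.
- have /ffunP/(_ (exist _ i iS)) := eq_xy; rewrite !ffunE => /rowP/(_ l).
  by rewrite !mxE.
Qed.

Theorem theorem2 (F : finFieldType) (m N s : nat) (w : F)
    (m_gt0 : (0 < m)%N) (N_gt0 : (0 < N)%N) (s_gt0 : (0 < s)%N)
    (le_mN : (m <= N)%N) (dvd_ms : (m %| s)%N)
    (le_NF : (N <= #|F|)%N) (w_prim : s.-primitive_root w) :
  is_minimum
    (fun k : nat => exists C : strategy F N s m, recovery_threshold w C k) m.
Proof.
split=> [|k [C [[le_kN rec_k] _]]]; last exact: recoverable_geq rec_k.
(* The evaluation points are the first [N] elements in the enumeration of [F]. *)
pose a (i : 'I_N) : F := enum_val (widen_ord le_NF i).
have a_inj : injective a.
  by move=> i j /enum_val_inj eq_ij; apply: val_inj; have [] := eq_ij.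
exists (block_code dvd_ms a); split=> [|k [le_kN rec_k]].
  by split=> //; apply: block_code_recoverable.
exact: recoverable_geq rec_k.
Qed.
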